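(* Up to isomorphism, the perspective torsion-free Abelian groups of rank $1$ are exactly the rational groups, i.e. the nonzero subgroups of $\mathbb{Q}$.
   Context: An Abelian group $G$ is called perspective if any two isomorphic direct summands of $G$ have a common direct complement: whenever $G=A\oplus H=B\oplus K$ with $A\cong B$, there exists a subgroup $C\le G$ with $G=A\oplus C=B\oplus C$. *)

(* Defs.v *)
From HB Require Import structures.
From mathcomp Require Import all_boot all_order all_algebra.

Set Implicit Arguments.
Unset Strict Implicit.
Unset Printing Implicit Defensive.

Import GRing.Theory.
Local Open Scope ring_scope.

(* A subgroup of V is an element of [zmodClosed V]. Its membership predicate is
   boolean; classically (e.g. through [boolp.asbool]) this covers all subgroups. *)

Record subgroup (V : zmodType) (H : zmodClosed V) : predArgType :=
  Subgroup { subgroup_val : V; subgroup_valP : subgroup_val \in H }.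

HB.instance Definition _ (V : zmodType) (H : zmodClosed V) :=
  [isSub for @subgroup_val V H].
HB.instance Definition _ (V : zmodType) (H : zmodClosed V) :=
  [Choice of subgroup H by <:].
HB.instance Definition _ (V : zmodType) (H : zmodClosed V) :=
  [SubChoice_isSubZmodule of subgroup H by <:].

Definition isomorphic (G H : zmodType) : Prop :=
  exists f : {additive G -> H}, bijective f.

Definition direct_sum (G : zmodType) (A H : zmodClosed G) : Prop :=
  (forall x, x \in A -> x \in H -> x = 0) /\
  (forall g, exists a h, [/\ a \in A, h \in H & g = a + h]).

Definition perspective (G : zmodType) : Prop :=
  forall A H B K : zmodClosed G,
    direct_sum A H -> direct_sum B K ->
    isomorphic (subgroup A) (subgroup B) ->
    exists C : zmodClosed G, direct_sum A C /\ direct_sum B C.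

Definition torsion_free (G : zmodType) : Prop :=
  forall (n : nat) (x : G), (0 < n)%N -> x *+ n = 0 -> x = 0.

Definition independent (G : zmodType) (s : seq G) : Prop :=
  forall c : 'I_(size s) -> int,
    \sum_(i < size s) s`_i *~ c i = 0 -> forall i, c i = 0.

(* G has a maximal independent system of n elements; all maximal independent
   systems have the same cardinality, so n is then the (torsion-free) rank. *)
Definition has_rank (G : zmodType) (n : nat) : Prop :=
  exists s : seq G,
    [/\ size s = n, independent s & forall y, ~ independent (y :: s)].

Definition nonzero_subgroup (V : zmodType) (H : zmodClosed V) : Prop :=
  exists2 x : V, x \in H & x != 0.

(* Main.v *)
Require Import Defs.
From HB Require Import structures.
From mathcomp Require Import all_boot all_order all_algebra.
From mathcomp Require Import boolp.

(** Both sides of the equivalence say that [G] is nonzero and embeds in [rat].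

    If [G] is torsion-free and [x] alone is a maximal independent system, every
    [y] satisfies [x *~ a = y *~ b] for some integers [a] and [b != 0].  The
    ratio [a / b] depends only on [y], because [G] has no torsion, and it is
    additive and injective in [y]; this is the embedding
    ([rank1_embeds_rat]), and [G] is isomorphic to its image
    ([injective_image]).

    Conversely, any two nonzero elements of a group embedded in [rat] have a
    common nonzero multiple ([rat_common_multiple]).  Hence a single nonzero
    element is a maximal independent system, and two subgroups with
    trivial intersection cannot both be nonzero.  The only direct decompositions
    are therefore the trivial ones, [G = G + 0] and [G = 0 + G], and the
    complement of [A] is also a complement of any summand isomorphic to [A],
    since [A] and that summand are both [0] or both [G]
    ([rat_embedded_perspective]). *)

Set Implicit Arguments.
Unset Strict Implicit.
Unset Printing Implicit Defensive.

Import GRing.Theory Num.Theory.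
Local Open Scope ring_scope.

Lemma independent1P (G : zmodType) (x : G) :
  independent [:: x] <-> (forall a : int, x *~ a = 0 -> a = 0).
Proof.
split=> [ind a xa0 | ind c].
  by apply: (ind (fun=> a) _ ord0); rewrite big_ord_recl big_ord0 addr0.
rewrite big_ord_recl big_ord0 addr0 /= => /ind c0 i.
by rewrite (ord1 i).
Qed.

Lemma independent2P (G : zmodType) (y x : G) :
  independent [:: y; x] <->
  (forall a b : int, y *~ a + x *~ b = 0 -> a = 0 /\ b = 0).
Proof.
split=> [ind a b yx0 | ind c].
  have c0 : forall i : 'I_2, (if i == 0 then a else b) = 0.
    by apply: ind; rewrite !big_ord_recl big_ord0 addr0.
  by split; [exact: (c0 0) | exact: (c0 1)].
rewrite !big_ord_recl big_ord0 addr0 /= => /ind[c0 c1] i.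
have [->|->] : i = ord0 \/ i = lift ord0 ord0; last 2 first.
- exact: c0.
- exact: c1.
case: i => [[|[|//]] lti]; [left | right]; exact: val_inj.
Qed.

Lemma torsion_free_mulrz (G : zmodType) (x : G) (a : int) :
  torsion_free G -> a != 0 -> x *~ a = 0 -> x = 0.
Proof.
move=> tfG; case: a => n.
  by move=> n0; apply: tfG; rewrite lt0n.
move=> _; rewrite NegzE mulrNz => /eqP; rewrite oppr_eq0 => /eqP.
exact: tfG.
Qed.

Lemma torsion_free_mulrzI (G : zmodType) (x y : G) (a : int) :
  torsion_free G -> a != 0 -> x *~ a = y *~ a -> x = y.
Proof.
move=> tfG a0 xya; apply/eqP; rewrite -subr_eq0; apply/eqP.
by apply: (torsion_free_mulrz tfG a0); rewrite mulrzBl xya subrr.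
Qed.

Lemma eq_numq_denq (q : rat) (a b : int) :
  b != 0 -> (q == a%:~R / b%:~R) = (numq q * b == a * denq q).
Proof.
move=> b0; rewrite -{1}[q]divq_num_den.
by rewrite eqr_div ?intr_eq0 ?denq_neq0 // -!intrM eqr_int.
Qed.

(** Stating [y = q x] on the reduced fraction of [q] makes it a decidable
    condition, so that the coordinate of [y] can be picked by [xchoose]. *)
Definition coordinate (G : zmodType) (x y : G) (q : rat) : bool :=
  x *~ numq q == y *~ denq q.

(** Any relation [x *~ a = y *~ b] computes the coordinate: without torsion it
    can be multiplied or divided by a nonzero integer. *)
Lemma coordinateE (G : zmodType) (x y : G) (a b : int) (q : rat) :
  torsion_free G -> x != 0 -> b != 0 -> x *~ a = y *~ b ->
  coordinate x y q = (q == a%:~R / b%:~R).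
Proof.
move=> tfG x0 b0 xayb; rewrite eq_numq_denq //; apply/eqP/eqP => [xq | qE].
  apply/eqP; rewrite -subr_eq0; apply: contraNT x0 => d0; apply/eqP.
  apply: (torsion_free_mulrz tfG d0).
  by rewrite mulrzBr !mulrzA xq xayb mulrzAC subrr.
apply: (torsion_free_mulrzI tfG b0).
by rewrite -mulrzA qE mulrzA xayb mulrzAC.
Qed.

Lemma rank1_coordinate (G : zmodType) (x y : G) :
  torsion_free G -> independent [:: x] -> ~ independent [:: y; x] ->
  exists q, coordinate x y q.
Proof.
move=> tfG /independent1P indx /independent2P dep.
have x0 : x != 0.
  by apply/eqP => x0; have := indx 1; rewrite x0 mul0rz => /(_ erefl).
apply: contrapT => noq; apply: dep => b a yx0.
have [b0 | b0] := eqVneq b 0.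
  by split=> //; apply: indx; rewrite -yx0 b0 mulr0z add0r.
case: noq; exists ((- a)%:~R / b%:~R).
rewrite (@coordinateE _ _ _ (- a) b) //.
by apply/eqP; rewrite mulrNz eq_sym -addr_eq0 yx0.
Qed.

Lemma rank1_embeds_rat (G : zmodType) :
  torsion_free G -> has_rank G 1 ->
  (exists x : G, x != 0) /\ exists f : {additive G -> rat}, injective f.
Proof.
move=> tfG [[|x [|x' s]] [szs indx maxx]] // {szs}.
have x0 : x != 0.
  apply/eqP => x0; have /independent1P/(_ 1) := indx.
  by rewrite x0 mul0rz => /(_ erefl).
split; first by exists x.
have exq y : exists q, coordinate x y q by exact: rank1_coordinate.
pose f y := xchoose (exq y).
have fP y : x *~ numq (f y) = y *~ denq (f y) by apply/eqP/(xchooseP (exq y)).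
have fE y a b : b != 0 -> x *~ a = y *~ b -> f y = a%:~R / b%:~R.
  move=> b0 xayb; apply/eqP; rewrite -(coordinateE _ tfG x0 b0 xayb).
  exact: xchooseP.
have fB : zmod_morphism f.
  move=> y z.
  (* subtract the two relations over the common denominator *)
  rewrite (@fE (y - z) (numq (f y) * denq (f z) - numq (f z) * denq (f y))
                       (denq (f y) * denq (f z))).
  - rewrite intrB !intrM -[in RHS](divq_num_den (f y)).
    rewrite -[in RHS](divq_num_den (f z)) -[in RHS]mulNr addf_div ?intr_eq0 ?denq_neq0 //.
    by rewrite mulNr.
  - by rewrite mulf_neq0 ?denq_neq0.
  - rewrite mulrzBr mulrzBl !mulrzA !fP.
    by congr (_ - _); rewrite mulrzAC.
pose F : {additive G -> rat} :=
  HB.pack f (GRing.isZmodMorphism.Build G rat f fB).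
exists F; apply: raddf_inj => y fy0.
by have := fP y; rewrite (_ : f y = 0) //.
Qed.

(** Membership in the image is made boolean classically; the inverse map is
    a choice of preimage. *)
Lemma injective_image (G V : zmodType) (f : {additive G -> V}) :
  injective f ->
  exists H : zmodClosed V,
    (forall y, f y \in H) /\ isomorphic G (subgroup H).
Proof.
move=> injf.
pose P : {pred V} := fun v => `[< exists y, f y = v >].
have Pzmod : zmod_closed P.
  split; first by apply/asboolP; exists 0; rewrite raddf0.
  move=> _ _ /asboolP[y <-] /asboolP[z <-].
  by apply/asboolP; exists (y - z); rewrite raddfB.
pose H : zmodClosed V := HB.pack P (GRing.isZmodClosed.Build V P Pzmod).
have fH y : f y \in H by apply/asboolP; exists y.
exists H; split=> //.
pose g y : subgroup H := Subgroup (fH y).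
have gB : zmod_morphism g by move=> y z; apply: val_inj; rewrite /= raddfB.
pose g' : {additive G -> subgroup H} :=
  HB.pack g (GRing.isZmodMorphism.Build G (subgroup H) g gB).
exists g'.
have exf (u : subgroup H) : exists y, f y == val u.
  by have /asboolP[y fy] := subgroup_valP u; exists y; apply/eqP.
exists (fun u => xchoose (exf u)) => [y | u].
  by apply: injf; apply/eqP/(xchooseP (exf (g' y))).
by apply: val_inj; apply/eqP/(xchooseP (exf u)).
Qed.

(** Cross-multiply the numerators and denominators of [f x] and [f y]. *)
Lemma rat_common_multiple (G : zmodType) (f : {additive G -> rat}) (x y : G) :
  injective f -> x != 0 -> y != 0 ->
  exists a b : int, [/\ a != 0, b != 0 & x *~ a = y *~ b].
Proof.
move=> injf x0 y0.
have f0 z : z != 0 -> f z != 0.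
  by apply: contraNneq => fz0; apply/eqP/injf; rewrite fz0 raddf0.
exists (denq (f x) * numq (f y)), (denq (f y) * numq (f x)).
split; rewrite ?mulf_neq0 ?denq_neq0 ?numq_eq0 ?f0 //.
apply: injf; rewrite !raddfMz -[LHS]mulrzr -[RHS]mulrzr !intrM !numqE.
by rewrite [LHS]mulrA [RHS]mulrA mulrC.
Qed.

Lemma rat_embedded_torsion_free (G : zmodType) (f : {additive G -> rat}) :
  injective f -> torsion_free G.
Proof.
move=> injf n x n0 xn0; apply: injf; rewrite raddf0.
have /eqP := congr1 f xn0.
by rewrite raddfMn raddf0 mulrn_eq0 eqn0Ngt n0 => /eqP.
Qed.

Lemma rat_embedded_rank1 (G : zmodType) (f : {additive G -> rat}) (x : G) :
  injective f -> x != 0 -> has_rank G 1.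
Proof.
move=> injf x0; have tfG := rat_embedded_torsion_free injf.
exists [:: x]; split=> //.
  apply/independent1P => a xa0; apply: contra_eq xa0 => a0.
  by apply: contraNneq x0 => /(torsion_free_mulrz tfG a0) ->.
move=> y /independent2P ind.
have [y0 | y0] := eqVneq y 0.
  by have [] := ind 1 0; rewrite ?y0 ?mulr0z ?mul0rz ?addr0.
have [a [b [a0 _ yaxb]]] := rat_common_multiple injf y0 x0.
have [|/eqP] := ind a (- b); first by rewrite mulrNz yaxb subrr.
by rewrite (negPf a0).
Qed.

(** A direct decomposition is trivial: nonzero elements of the two summands
    would have a common nonzero multiple in the intersection. *)
Lemma rat_embedded_direct_sum (G : zmodType) (f : {additive G -> rat})
    (A H : zmodClosed G) :
  injective f -> direct_sum A H ->
  (forall x, x \in A -> x = 0) \/ (forall x, x \in H -> x = 0).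
Proof.
move=> injf [AH0 _]; have tfG := rat_embedded_torsion_free injf.
apply: contrapT => /not_orP[nA nH]; apply: nA => x xA; apply/eqP.
apply: contrapT => /negP x0; apply: nH => y yH; apply/eqP.
apply: contrapT => /negP y0.
have [a [b [a0 _ xayb]]] := rat_common_multiple injf x0 y0.
move/eqP: x0; apply; apply: (torsion_free_mulrz tfG a0).
by apply: AH0; [|rewrite xayb]; rewrite rpredMz.
Qed.

Lemma isomorphic_sym (G H : zmodType) : isomorphic G H -> isomorphic H G.
Proof.
case=> f [g fK gK]; have gB : zmod_morphism g := can2_zmod_morphism fK gK.
pose g' : {additive H -> G} :=
  HB.pack g (GRing.isZmodMorphism.Build H G g gB).
by exists g', f.
Qed.

Lemma isomorphic_trivial (G : zmodType) (A B : zmodClosed G) :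
  isomorphic (subgroup A) (subgroup B) ->
  (forall x, x \in A -> x = 0) -> (forall x, x \in B -> x = 0).
Proof.
move=> [f [g fK gK]] A0 x xB.
rewrite -[x]/(val (Subgroup xB)) -[Subgroup xB]gK.
have -> : g (Subgroup xB) = 0 by apply: val_inj; apply: A0; apply: subgroup_valP.
by rewrite raddf0.
Qed.

Lemma direct_sum_trivialr (G : zmodType) (A H : zmodClosed G) :
  direct_sum A H -> (forall x, x \in H -> x = 0) -> forall x, x \in A.
Proof.
move=> [_ sumAH] H0 x; have [a [h [aA hH ->]]] := sumAH x.
by rewrite (H0 h hH) addr0.
Qed.

Lemma direct_sum_triviall (G : zmodType) (A H : zmodClosed G) :
  direct_sum A H -> (forall x, x \in A -> x = 0) -> forall x, x \in H.
Proof.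
move=> [_ sumAH] A0 x; have [a [h [aA hH ->]]] := sumAH x.
by rewrite (A0 a aA) add0r.
Qed.

(** By triviality of decompositions [A] and [B] are both [0] or both [G], so the
    given complement [H] of [A] is itself the common complement. *)
Lemma rat_embedded_perspective (G : zmodType) (f : {additive G -> rat}) :
  injective f -> perspective G.
Proof.
move=> injf A H B K dAH dBK AB; exists H; split=> //.
case: (rat_embedded_direct_sum injf dAH) => [A0 | H0].
  have HT := direct_sum_triviall dAH A0.
  have B0 := isomorphic_trivial AB A0.
  split=> [x /B0 //| g]; exists 0, g.
  by rewrite add0r HT rpred0.
have BT : forall x, x \in B.
  case: (rat_embedded_direct_sum injf dBK) => [B0 x | K0].
    (* here [B], hence also [A], and so the whole of [G], vanishes *)
    have A0 := isomorphic_trivial (isomorphic_sym AB) B0.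
    by rewrite (H0 x (direct_sum_triviall dAH A0 x)) rpred0.
  exact: direct_sum_trivialr dBK K0.
split=> [x _ /H0 //| g]; exists g, 0.
by rewrite addr0 BT rpred0.
Qed.

Theorem proposition3p14 (G : zmodType) :
  (perspective G /\ torsion_free G /\ has_rank G 1) <->
  (exists H : zmodClosed rat,
     nonzero_subgroup H /\ isomorphic G (subgroup H)).
Proof.
split=> [[_ [tfG rkG]] | [H [[q qH q0] [f bijf]]]].
  have [[x x0] [f injf]] := rank1_embeds_rat tfG rkG.
  have [H [fH isoGH]] := injective_image injf.
  exists H; split=> //; exists (f x) => //.
  by apply: contraNneq x0 => fx0; apply/eqP/injf; rewrite fx0 raddf0.
pose F : {additive G -> rat} := \val \o f.
have injF : injective F by apply: inj_comp; [exact: val_inj | exact: bij_inj].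
have [g _ gK] := bijf.
have x0 : g (Subgroup qH) != 0.
  apply: contraNneq q0 => x0.
  by rewrite -[q]/(val (Subgroup qH)) -[Subgroup qH]gK x0 raddf0.
split; first exact: rat_embedded_perspective injF.
split; first exact: rat_embedded_torsion_free injF.
exact: rat_embedded_rank1 injF x0.
Qed.
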